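(* Let $V$ be a topological vector space which is also a Baire space. If $(E_n)_{n\in\mathbb{N}}$ is a sequence of $P$-subspaces of $V$ such that $\bigcup_{n\in\mathbb{N}} E_n = V$, then there is $n_0\in\mathbb{N}$ with $E_{n_0}=V$.
   Context: $V$ is a topological vector space over $\mathbb{K}\in\{\mathbb{R},\mathbb{C}\}$, and $\mathbb{N}=\{1,2,3,\dots\}$. A topological space is a Baire space if every non-empty open subset is of second category (i.e. not meagre: not a countable union of nowhere dense sets). Write $\overline{\mathbb{R}}_{\ge 0}=[0,\infty)\cup\{+\infty\}$. An extended seminorm on $V$ is a function $p:V\to\overline{\mathbb{R}}_{\ge 0}$ with $p(\lambda x)=|\lambda|p(x)$ for all $\lambda\in\mathbb{K}$, $x\in V$ (with the convention $0\cdot\infty=0$) and $p(x+y)\le p(x)+p(y)$ for all $x,y\in V$. Put $[p\le 1]=\{x\in V: p(x)\le 1\}$ and $[p<\infty]=\{x\in V: p(x)<\infty\}$. A linear subspace $E\subseteq V$ is called a $P$-subspace of $V$ if there exist an index set $I$, a countable set $Q_i$ for each $i\in I$, and an extended seminorm $p_{i,q}:V\to\overline{\mathbb{R}}_{\ge 0}$ for each $i\in I$ and $q\in Q_i$, such that: (i) for all $i\in I$ and $q\in Q_i$ the set $[p_{i,q}\le 1]$ is closed in $V$; (ii) $E\subseteq\bigcap_{i\in I}\bigcup_{q\in Q_i}[p_{i,q}<\infty]$; (iii) for every net $(x_\alpha)_\alpha$ in $E$ converging in $V$ to some $x\in V$: if for every $i\in I$ there exists $q_i\in Q_i$ with $p_{i,q_i}(x-x_\alpha)\to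 0$ along $\alpha$, then $x\in E$. *)

(* Defs.v *)
From mathcomp Require Import all_boot all_order all_algebra.
From mathcomp Require Import complex.
From mathcomp Require Import all_classical all_reals all_analysis.

Set Implicit Arguments.
Unset Strict Implicit.
Unset Printing Implicit Defensive.

Import Order.TTheory GRing.Theory Num.Theory.
Import numFieldNormedType.Exports.

Local Open Scope classical_set_scope.
Local Open Scope ring_scope.

Definition nowhere_dense (T : topologicalType) (A : set T) : Prop :=
  (closure A)° = set0.

(* First category. A [nat]-indexed union also covers finite unions, since
   [set0] is nowhere dense. *)
Definition meagre (T : topologicalType) (A : set T) : Prop :=
  exists F : (set T)^nat,
    (forall n, nowhere_dense (F n)) /\ A = \bigcup_n F n.

Definition baire_space (T : topologicalType) : Prop :=
  forall U : set T, open U -> U !=set0 -> ~ meagre U.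

(* [le] need not be antisymmetric. *)
Definition directed_set (A : Type) (le : A -> A -> Prop) : Prop :=
  [/\ inhabited A,
      forall a, le a a,
      forall a b c, le a b -> le b c -> le a c &
      forall a b, exists2 c, le a c & le b c].

(* A net [u : A -> T] converges to [x] when [u @ tails le --> x]. *)
Definition tails (A : Type) (le : A -> A -> Prop) : set_system A :=
  [set S | exists a, forall b, le a b -> S b].

Section ScalarField.

(* The field of scalars K is the field of real or of complex numbers; [abs] is
   its modulus, with values in R. The norm `|_| of MathComp is valued in K
   itself, hence does not provide it when K = R[i]. *)
Variables (R : realType) (K : numFieldType) (abs : K -> R).

(* In \bar R, 0 * +oo = 0. *)
Definition extended_seminorm (V : lmodType K) (p : V -> \bar R) : Prop :=
  [/\ forall x, (0 <= p x)%E,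
      forall (l : K) (x : V), p (l *: x) = ((abs l)%:E * p x)%E &
      forall x y : V, (p (x + y)%R <= p x + p y)%E].

Definition P_subspace (V : topologicalLmodType K) (E : set V) : Prop :=
  submod_closed (mem E) /\
  exists (I : Type) (Q : I -> Type) (p : forall i, Q i -> V -> \bar R),
    [/\ forall i, countable [set: Q i],
        forall i q, extended_seminorm (p i q),
        forall i q, closed [set x | (p i q x <= 1)%E],
        E `<=` \bigcap_i \bigcup_q [set x | (p i q x < +oo)%E] &
        forall (A : Type) (le : A -> A -> Prop) (u : A -> V) (x : V),
          directed_set le -> (forall a, E (u a)) ->
          u @ tails le --> x ->
          (forall i, exists q,
             (fun a => p i q (x - u a)%R) @ tails le --> (0%E : \bar R)) ->
          E x].

End ScalarField.

(* Main.v *)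
Require Import Defs.
From mathcomp Require Import all_boot all_order all_algebra.
From mathcomp Require Import complex.
From mathcomp Require Import all_classical all_reals all_analysis.

Set Implicit Arguments.
Unset Strict Implicit.
Unset Printing Implicit Defensive.

Import Order.TTheory GRing.Theory Num.Theory.
Import numFieldNormedType.Exports.

Local Open Scope classical_set_scope.
Local Open Scope ring_scope.

(** Since V is a nonempty Baire space, some E n is not meagre, and the claim is
    that a nonmeagre P-subspace E is the whole space.

    Fix an index i. The sets [p i q < +oo], for q in the countable set Q i,
    cover E, and each of them is the union over n of the sets
    [p i q <= n + 1], which are closed as dilations of [p i q <= 1]. As E is
    not meagre, one of these countably many closed sets has an interior point.
    Subtracting that point from its neighbours shows that p i q is bounded near
    0, hence, by homogeneity, small near 0
    ([extended_seminorm_continuous0]). So for every i some p i q tends to 0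
    along x - u a whenever a net u converges to x: the seminorm condition on
    nets in the definition of a P-subspace is then automatic, and E contains
    the limits of all of its convergent nets, i.e. E is closed
    ([nonmeagre_P_subspace_closed]).

    A closed set that is not meagre has an interior point, and a linear
    subspace with an interior point is everything ([submod_interior_setT]).

    Real and complex scalars are treated at once: all that is used of the
    modulus is its value at -1 and at the inverses of positive integers. *)

Section Meagre.
Context (T : topologicalType).
Implicit Types A B : set T.

Lemma nowhere_denseS A B : A `<=` B -> nowhere_dense B -> nowhere_dense A.
Proof.
move=> AB; rewrite /nowhere_dense -!subset0; apply: subset_trans.
exact/interiorS/closureS.
Qed.

(** The index type I is only known to inject into nat, and need not have a
    decidable equality. Therefore the double family G i k is enumerated by
    tagging it with the code of (f i, k), where f is the injection; the sets
    whose number is no such code are empty. *)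
Lemma meagre_bigcup (I : Type) (F : I -> set T) A :
  countable [set: I] -> (forall i, meagre (F i)) -> A `<=` \bigcup_i F i ->
  meagre A.
Proof.
move=> /countable_injP[f finj] /choice[G GF] AF.
have fI i j : f i = f j -> i = j by apply: finj; rewrite in_setT.
pose H n : set T := A `&` [set x | exists i (k : nat), n = pickle (f i, k) /\ G i k x].
exists H; split=> [n|].
  have [[i [k nE]]|nP] := pselect (exists i (k : nat), n = pickle (f i, k)).
    apply: (@nowhere_denseS _ (G i k)); last exact: (proj1 (GF i) k).
    move=> x [_ [j [l []]]] /=.
    by rewrite nE => /(pcan_inj pickleK)[] /fI <- <-.
  suff -> : H n = set0 by rewrite /nowhere_dense closure0 interior0.
  rewrite -subset0 => x [_ [i [k [nE _]]]].
  by apply: nP; exists i, k.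
apply/seteqP; split=> [x Ax|x [n _ []]//].
have [i _] := AF x Ax; rewrite (proj2 (GF i)) => -[k _ Gx].
by exists (pickle (f i, k)) => //; split=> //; exists i, k.
Qed.

Lemma meagre_closed A : closed A -> A° = set0 -> meagre A.
Proof.
move=> Acl A0; exists (fun=> A); split=> [_|].
  by rewrite /nowhere_dense -(proj1 (closure_id A) Acl).
by rewrite bigcup_const //; exists 0%N.
Qed.

End Meagre.

Section TopologicalLmodule.
Context (K : numFieldType) (V : topologicalLmodType K).

Lemma cvg_affine (T : Type) (F : set_system T) (FF : Filter F) (x y : V)
    (c : K^o) (f : T -> K^o) (g : T -> V) :
  f @ F --> c -> g @ F --> y -> (fun t => x + f t *: g t) @ F --> x + c *: y.
Proof.
move=> fc gy.
apply: (@continuous2_cvg _ _ _ _ _ _ (fun=> x) (fun t => f t *: g t)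
  (fun a b : V => a + b)).
- exact: add_continuous (x, c *: y).
- exact: cvg_cst.
- apply: (@continuous2_cvg _ _ _ _ _ _ f g
    (fun (a : K^o) (v : V) => a *: v)) => //.
  exact: scale_continuous (c, y).
Qed.

Lemma affine_continuousr (x : V) (c : K) : continuous (fun y : V => x + c *: y).
Proof.
move=> y.
by apply: (@cvg_affine V (nbhs y) _ x y c (fun=> c) id) => //; exact: cvg_cst.
Qed.

Lemma affine_continuousl (x y : V) : continuous (fun c : K^o => x + c *: y).
Proof.
move=> c.
by apply: (@cvg_affine K^o (nbhs c) _ x y c id (fun=> y)) => //; exact: cvg_cst.
Qed.

(** If x is interior to E, then x + c *: y stays in E for a small c != 0, and
    y is recovered by subtracting x and dividing by c. *)
Lemma submod_interior_setT (E : set V) :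
  submod_closed (mem E) -> E° !=set0 -> E = setT.
Proof.
move=> [E0 Elin] [x Ex]; apply/seteqP; split=> // y _.
have /= := @affine_continuousl x y 0 E.
rewrite scale0r addr0 => /(_ Ex) /nbhs_ballP[e /= e0 xE].
have e2 : e / 2 != 0 by rewrite mulf_neq0 ?invr_eq0 ?pnatr_eq0 ?gt_eqF.
have Exy : E (x + (e / 2) *: y).
  apply: (xE (e / 2)); rewrite /ball /= sub0r normrN gtr0_norm ?divr_gt0 //.
  by rewrite ltr_pdivrMr // ltr_pMr // ltr1n.
have Eey : (e / 2) *: y \in E.
  have /= := Elin (-1) x (x + (e / 2) *: y).
  rewrite scaleN1r addKr; apply; rewrite inE //.
  exact: interior_subset Ex.
have /= := Elin (e / 2)^-1 _ 0 Eey E0.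
by rewrite scalerK // addr0 => /set_mem.
Qed.

End TopologicalLmodule.

Section Psubspace.
Context (R : realType) (K : numFieldType) (abs : K -> R).
Hypothesis absN1 : abs (-1) = 1.
Hypothesis absV : forall n, abs n.+1%:R^-1 = n.+1%:R^-1.
Context (V : topologicalLmodType K).

Lemma extended_seminormN (p : V -> \bar R) (x : V) :
  extended_seminorm abs p -> p (- x) = p x.
Proof. by move=> [_ pZ _]; rewrite -scaleN1r pZ absN1 mul1e. Qed.

(** If x is interior to [p <= n + 1], then p <= 2 (n + 1) on a neighbourhood of
    0, by the triangle inequality and p (- x) = p x; shrinking that
    neighbourhood by a large factor makes p small. The sublevel set is written
    with the scalar inside p, which exhibits it as a preimage of [p <= 1]. *)
Lemma extended_seminorm_continuous0 (p : V -> \bar R) (n : nat) (e : R) :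
  extended_seminorm abs p -> [set x | (p (n.+1%:R^-1 *: x) <= 1)%E]° !=set0 ->
  0 < e -> \forall y \near (0 : V), (p y < e%:E)%E.
Proof.
move=> psn [x Ax] e0; have [_ pZ pD] := psn.
(* m is such that 2 / (m + 1) < e; below, y is so close to 0 that
   (n + 1) (m + 1) y is in the neighbourhood on which p <= 2 (n + 1). *)
set m := Num.truncn (2 / e).
have me : 2 / e < m.+1%:R by rewrite truncnS_gt.
have : \forall y \near (0 : V),
    (p (n.+1%:R^-1 *: (x + (n.+1%:R * m.+1%:R) *: y)) <= 1)%E.
  apply: (@affine_continuousr _ V x (n.+1%:R * m.+1%:R) 0
    [set x | (p (n.+1%:R^-1 *: x) <= 1)%E]).
  by rewrite scaler0 addr0.
apply: filterS => y px.
have px0 : (p (n.+1%:R^-1 *: x) <= 1)%E := interior_subset Ax.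
have pmy : (p (m.+1%:R *: y) <= 2%:E)%E.
  have -> : m.+1%:R *: y = n.+1%:R^-1 *: (x + (n.+1%:R * m.+1%:R) *: y)
                           - n.+1%:R^-1 *: x.
    by rewrite scalerDr addrAC subrr add0r scalerA mulKf ?pnatr_eq0.
  apply: le_trans (pD _ _) _; rewrite (extended_seminormN _ psn).
  by rewrite (_ : 2%:E = 1 + 1)%E ?EFinD // leeD.
have -> : y = m.+1%:R^-1 *: (m.+1%:R *: y) by rewrite scalerK ?pnatr_eq0.
rewrite pZ absV; apply: (@le_lt_trans _ _ (m.+1%:R^-1 * 2)%:E).
  by rewrite EFinM lee_pmul2l // lte_fin.
by rewrite lte_fin mulrC ltr_pdivrMr // mulrC -ltr_pdivrMr.
Qed.

(** Closedness is reached through the net indexed by the neighbourhoods of a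
    point x of the closure, ordered by reverse inclusion, that picks a point of
    E in each of them. *)
Lemma nonmeagre_P_subspace_closed (E : set V) :
  P_subspace abs E -> ~ meagre E -> closed E.
Proof.
move=> [_ [I [Q [p [Qc psn pcl Efin Enet]]]]] Em.
have qP i : exists q, exists n,
    [set x | (p i q (n.+1%:R^-1 *: x) <= 1)%E]° !=set0.
  apply: contrapT => noq; apply: Em.
  apply: (@meagre_bigcup _ _ (fun q => [set x | (p i q x < +oo)%E]) _ (Qc i)).
    move=> q; have [p0 pZ _] := psn i q.
    apply: (@meagre_bigcup _ nat
        (fun n => [set x | (p i q (n.+1%:R^-1 *: x) <= 1)%E])) => //.
      move=> n; apply: meagre_closed.
        apply: (@closed_comp _ _ (fun x : V => n.+1%:R^-1 *: x)
          [set x | (p i q x <= 1)%E]); last exact: pcl.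
        move=> x _; have := @affine_continuousr _ V 0 n.+1%:R^-1 x.
        by under eq_fun do rewrite add0r.
      apply/eqP/negPn/negP => /set0P ne.
      by apply: noq; exists q, n.
    move=> x /= pfin.
    have pxE : p i q x = (fine (p i q x))%:E.
      by rewrite fineK // ge0_fin_numE.
    exists (Num.truncn (fine (p i q x))) => //=.
    rewrite pZ absV pxE -EFinM lee_fin /= mulrC ler_pdivrMr // mul1r.
    by rewrite ltW // truncnS_gt.
  move=> x Ex; have [r _ rx] := Efin x Ex i Logic.I.
  by exists r.
move=> x xE.
have /choice[u uP] : forall U : {U : set V | nbhs x U},
    exists y, E y /\ sval U y.
  by move=> [U xU]; have [y []] := xE U xU; exists y.
pose le (U W : {U : set V | nbhs x U}) := sval W `<=` sval U.
have le_cvg (U : set V) : nbhs x U -> tails le [set W | U (u W)].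
  by move=> xU; exists (exist _ U xU) => W WU; apply: WU; case: (uP W).
apply: (Enet _ le u).
- split.
  + by split; exists setT; exact: filterT.
  + by move=> U.
  + by move=> U W Z UW WZ; exact: subset_trans WZ UW.
  + move=> [U xU] [W xW]; exists (exist _ (U `&` W) (filterI xU xW)).
    * by move=> ? [].
    * by move=> ? [].
- by move=> W; case: (uP W).
- by move=> U /le_cvg.
- move=> i; have [q [n An]] := qP i; exists q => S /= S0.
  have /nbhs_ballP[e /= e0 eS] : nbhs (0 : R) [set r | S r%:E] by [].
  have [p0 _ _] := psn i q.
  apply: (le_cvg [set y | S (p i q (x - y))]).
  have small := extended_seminorm_continuous0 (psn i q) An e0.
  have : \forall y \near x, (p i q (x + -1 *: y)%R < e%:E)%E.
    apply: (@affine_continuousr _ V x (-1) x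
      [set y | (p i q y < e%:E)%E]).
    by rewrite scaleN1r subrr.
  apply: filterS => y; rewrite scaleN1r => pxy.
  have pf : p i q (x - y) \is a fin_num.
    by rewrite ge0_fin_numE // (lt_trans pxy) // ltry.
  rewrite /= -(fineK pf); apply: eS.
  rewrite /ball /= sub0r normrN ger0_norm ?fine_ge0 //.
  by rewrite -lte_fin fineK.
Qed.

Lemma P_subspace_cover (E : (set V)^nat) :
  baire_space V -> (forall n, P_subspace abs (E n)) ->
  \bigcup_n E n = [set: V] -> exists n0, E n0 = [set: V].
Proof.
move=> BV EP Ecover.
have [n Em] : exists n, ~ meagre (E n).
  apply: contrapT => /forallNP Em; apply: (BV setT); first exact: openT.
    by exists 0.
  apply: (@meagre_bigcup _ _ E) => [|k|x _]; last by rewrite Ecover.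
  - exact: countableP.
  - by apply: contrapT; exact: Em.
exists n; apply: submod_interior_setT; first by case: (EP n).
have Ecl := nonmeagre_P_subspace_closed (EP n) Em.
by apply/set0P/eqP => E0; exact/Em/meagre_closed.
Qed.

End Psubspace.

Theorem proposition2p14 (R : realType) :
  (forall (V : topologicalLmodType R) (E : (set V)^nat),
     baire_space V ->
     (forall n, P_subspace (fun l : R => `|l|) (E n)) ->
     \bigcup_n E n = [set: V] ->
     exists n0, E n0 = [set: V])
  /\
  (forall (V : topologicalLmodType R[i]) (E : (set V)^nat),
     baire_space V ->
     (forall n, P_subspace (fun l : R[i] => Normc.normc l) (E n)) ->
     \bigcup_n E n = [set: V] ->
     exists n0, E n0 = [set: V]).
Proof.
split=> V E; apply: P_subspace_cover => [|n].
- by rewrite normrN1.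
- by rewrite normfV normr_nat.
- by rewrite normcN Normc.normc1.
- by rewrite Normc.normcV normcMn Normc.normc1.
Qed.
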